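(* For all $k\in[n_r]$, let $h_k(u,v)=(h'_k(u),h''_k(v))$, where each of the hash functions $h'_k$ and $h''_k$ is chosen uniformly at random from a pairwise-independent family; both cases $h'=h''$ and $h'\neq h''$ are allowed. Let $\epsilon>0$, fix $\delta>0$, and set $n_r=\lceil \ln\frac1\delta\rceil$ and $n_b=\lceil \frac{e}{\epsilon}\rceil$. Then, with probability at least $1-\delta$, $$\hat y(u,v)\le y(u,v)+\epsilon M .$$
   Context: $[n_r]=\{1,\dots,n_r\}$. A 3-dimensional higher-order count-min sketch (H-CMS) consists of $n_r$ hash functions and, for each $j\in[n_r]$, a matrix $\mathcal M_j$ of size $n_b\times n_b$, initially zero. The hash functions $h'_j,h''_j$ map nodes to $\{0,\dots,n_b-1\}$; the $j$-th hash function $h_j$ maps an edge $(u,v)$ to the matrix index $(h'_j(u),h''_j(v))$. When an edge $(u,v)$ is observed, the entry $\mathcal M_j[h'_j(u)][h''_j(v)]$ is increased by its count for every $j\in[n_r]$. For a pair $(u,v)$, $y(u,v)$ denotes the true count of $(u,v)$ observed thus far, $\hat y(u,v)=\min_{j\in[n_r]}\mathcal M_j[h'_j(u)][h''_j(v)]$ is its estimate from the H-CMS, and $M=\sum_{u,v}y(u,v)$ is the number of all observations so far. *)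

(* Defs.v *)
From mathcomp Require Export all_boot all_order all_algebra.
From mathcomp Require Export all_classical all_reals all_analysis.
Export Order.TTheory GRing.Theory Num.Theory.

Set Implicit Arguments.
Unset Strict Implicit.
Unset Printing Implicit Defensive.

Local Open Scope classical_set_scope.
Local Open Scope ring_scope.

Notation hash_function V n := {ffun V -> 'I_n}.

(* A stream lists the observed edges in order, each with its count. *)
Definition stream (V : Type) : Type := seq ((V * V) * nat).

Definition true_count (V : finType) (s : stream V) (u v : V) : nat :=
  (\sum_(e <- s | e.1 == (u, v)) e.2)%N.

Definition total_count (V : finType) (s : stream V) : nat :=
  (\sum_(u : V) \sum_(v : V) true_count s u v)%N.

Definition sketch_update (V : finType) (n : nat) (h' h'' : hash_function V n)
    (A : 'M[nat]_n) (e : (V * V) * nat) : 'M[nat]_n :=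
  \matrix_(a, b)
    (if (a == h' e.1.1) && (b == h'' e.1.2) then A a b + e.2 else A a b)%N.

Definition sketch_matrix (V : finType) (n : nat) (h' h'' : hash_function V n)
    (s : stream V) : 'M[nat]_n :=
  foldl (sketch_update h' h'') (const_mx 0%N) s.

(* Extended real valued so that the minimum over no row at all is +oo. *)
Definition estimate (R : realType) (V : finType) (nr nb : nat)
    (h' h'' : 'I_nr -> hash_function V nb) (s : stream V) (u v : V) : \bar R :=
  \big[Order.min/+oo%E]_(j < nr)
    ((sketch_matrix (h' j) (h'' j) s) (h' j u) (h'' j v))%:R%:E.

(* A family of hash functions is a finite sequence, so that repetitions
   (several seeds giving the same function) are allowed.  Under a uniform draw
   from H, the values at two distinct nodes are independent and uniform. *)
Definition pairwise_independent_family (V : finType) (n : nat)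
    (H : seq (hash_function V n)) : Prop :=
  forall (x y : V) (a b : 'I_n), x != y ->
    (count (fun f : hash_function V n => (f x == a) && (f y == b)) H)%:R
      / (size H)%:R = 1 / n%:R ^+ 2 :> rat.

Definition uniform_draw (d : measure_display) (T : measurableType d)
    (R : realType) (P : probability T R) (E : eqType) (H : seq E) (X : T -> E)
    : Prop :=
  forall f : E, measurable (X @^-1` [set f]) /\
    P (X @^-1` [set f]) = ((count_mem f H)%:R / (size H)%:R)%:E.

(* E is finite and carries the discrete sigma-algebra: A ranges over all sets. *)
Definition mutually_independent (d : measure_display) (T : measurableType d)
    (R : realType) (P : probability T R) (I E : finType) (X : I -> T -> E)
    : Prop :=
  forall (J : {set I}) (A : I -> set E),
    P (\bigcap_(k in [set` J]) (X k @^-1` A k))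
      = (\prod_(k in J) P (X k @^-1` A k))%E.

(* Main.v *)
(* In one row, the excess of the entry at (u, v) over the true count is the sum
   of the counts of the other edges that collide with (u, v).  An edge
   (x, y) <> (u, v) differs from it in one coordinate, and a collision forces a
   collision of the hash function of that coordinate, so it has probability at
   most 1 / nb <= eps / e, whatever the joint law of h' and h''.  By Markov's
   inequality the excess is larger than eps M with probability at most 1 / e,
   and by independence this happens in all nr rows with probability at most
   e ^ - nr <= delta. *)
Require Import Defs.

Set Implicit Arguments.
Unset Strict Implicit.
Unset Printing Implicit Defensive.

Local Open Scope classical_set_scope.
Local Open Scope ring_scope.

(** Induction is on the end of the stream, as [foldl] applies the last update outermost. *)
Lemma sketch_matrixE (V : finType) (n : nat) (f g : hash_function V n)
    (s : stream V) (a b : 'I_n) :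
  sketch_matrix f g s a b =
    (\sum_(e <- s | (f e.1.1 == a) && (g e.1.2 == b)) e.2)%N.
Proof.
rewrite /sketch_matrix; elim/last_ind: s => [|s e IHs].
  by rewrite big_nil mxE.
rewrite foldl_rcons mxE IHs -cats1 big_cat/= big_cons big_nil eq_sym (eq_sym b).
by case: ifP; rewrite ?addn0.
Qed.

Lemma total_countE (V : finType) (s : stream V) :
  total_count s = (\sum_(e <- s) e.2)%N.
Proof.
rewrite [RHS](partition_big fst predT)//= /total_count pair_big/=.
by apply: eq_bigr => -[x y] _.
Qed.

(** The edge [(u, v)] always hits its own entry. Collisions enter as 0/1 factors, so that the
    expected excess is linear in them. *)
Lemma sketch_matrix_excess (V : finType) (n : nat) (f g : hash_function V n)
    (s : stream V) (u v : V) :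
  sketch_matrix f g s (f u) (g v) =
    (true_count s u v +
     \sum_(e <- s | e.1 != (u, v))
        ((f e.1.1 == f u) && (g e.1.2 == g v)) * e.2)%N.
Proof.
rewrite sketch_matrixE (bigID (fun e => e.1 == (u, v)))/=; congr addn.
  apply: eq_bigl => -[[x y] c]/=.
  by have [[-> ->]|_] := (x, y) =P (u, v); rewrite ?eqxx ?andbF.
rewrite [LHS]big_mkcondl/=; apply: eq_bigr => e _.
by case: (_ && _); rewrite ?mul1n ?mul0n.
Qed.

(** A collision splits over the common value [a] into [n] disjoint cases of frequency [n ^- 2]
    each. *)
Lemma pairwise_independent_collision (R : realType) (V : finType) (n : nat)
    (H : seq (hash_function V n)) (x y : V) :
  pairwise_independent_family H -> (0 < n)%N -> x != y ->
  (count (fun f : hash_function V n => f x == f y) H)%:R / (size H)%:R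
    = n%:R^-1 :> R.
Proof.
move=> Hpw n0 xy.
have -> : count (fun f : hash_function V n => f x == f y) H =
    (\sum_a count (fun f : hash_function V n => (f x == a) && (f y == a)) H)%N.
  rewrite -sum1_count (partition_big (fun f : {ffun V -> 'I_n} => f y) predT)//=.
  apply: eq_bigr => a _; rewrite -sum1_count; apply: eq_bigl => f.
  by case: (f y =P a) => [->|_]; rewrite ?andbT ?andbF.
rewrite natr_sum mulr_suml (eq_bigr (fun=> n%:R ^- 2)) => [|a _].
  rewrite sumr_const card_ord -[_ *+ n]mulr_natl expr2 invfM mulrA.
  rewrite divff ?mul1r//.
  by rewrite pnatr_eq0 -lt0n.
(* The family is specified by an equation in [rat]; [ratr] carries it to [R]. *)
move/(congr1 (ratr : rat -> R)): (Hpw x y a a xy).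
by rewrite !fmorph_div rmorph1 rmorphXn/= !ratr_nat div1r.
Qed.

Section finite_valued.
Context (d : measure_display) (T : measurableType d) (R : realType)
  (P : probability T R) (E : finType) (X : T -> E).
Hypothesis mX : forall z, measurable (X @^-1` [set z]).

Lemma measurable_preimage_fin (A : set E) : measurable (X @^-1` A).
Proof.
rewrite -[A]image_id -bigcup_imset1 preimage_bigcup.
by apply: fin_bigcup_measurable.
Qed.

Lemma probability_preimage_fin (A : set E) :
  fine (P (X @^-1` A)) = \sum_(z | z \in A) fine (P (X @^-1` [set z])).
Proof.
have -> : P (X @^-1` A) = (\sum_(z | z \in A) P (X @^-1` [set z]))%E.
  rewrite -{1}[A]image_id -bigcup_imset1 preimage_bigcup.
  rewrite measure_fin_bigcup//;
    [|exact: finite_finset|exact: trivIset_preimage1].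
  rewrite (fsbigE [seq z <- index_enum E | z \in A]) ?filter_uniq//
    ?index_enum_uniq//.
  - by rewrite big_filter_cond; apply: eq_bigl => z; rewrite andbb.
  - by move=> z /=; rewrite mem_filter => /andP[/set_mem].
  - by move=> z Az; rewrite mem_filter mem_index_enum andbT mem_set.
by rewrite sum_fine// => z _; exact: fin_num_measure.
Qed.

Lemma markov_fin (F : E -> R) (c : R) : (forall z, 0 <= F z) ->
  c * fine (P (X @^-1` [set z | c < F z]))
    <= \sum_z fine (P (X @^-1` [set z])) * F z.
Proof.
move=> F0; rewrite probability_preimage_fin mulr_sumr big_mkcond/=.
apply: ler_sum => z _; rewrite mulrC.
have P0 : 0 <= fine (P (X @^-1` [set z])) by rewrite fine_ge0.
by case: ifPn => [/set_mem/ltW cF|_]; [exact: ler_wpM2l|exact: mulr_ge0].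
Qed.

End finite_valued.

(** Links the point masses of [uniform_draw], which are multiplicities in [H], to counts of
    collisions over [H]. *)
Lemma sum_count_mem (E : finType) (H : seq E) (a : pred E) :
  (\sum_(z | a z) count_mem z H)%N = count a H.
Proof.
rewrite -[RHS]sum1_count [RHS](partition_big id a)//=; apply: eq_bigr => z az.
rewrite -sum1_count; apply: eq_bigl => y /=.
by case: (y =P z) => [->|_]; rewrite ?az ?andbF.
Qed.

Section sketch_row.
Context (d : measure_display) (T : measurableType d) (R : realType)
  (P : probability T R) (V : finType) (n : nat).
Hypothesis n_gt0 : (0 < n)%N.

Lemma collision_probability (H : seq (hash_function V n))
    (h : T -> hash_function V n) (x y : V) :
  pairwise_independent_family H -> uniform_draw P H h -> x != y ->
  fine (P (h @^-1` [set f | f x == f y])) = n%:R^-1.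
Proof.
move=> Hpw Hh xy; rewrite probability_preimage_fin; last by move=> f; have [] := Hh f.
rewrite -(pairwise_independent_collision R Hpw n_gt0 xy) -sum_count_mem natr_sum.
rewrite mulr_suml; apply: eq_big => [f|f _]; first by
  apply/idP/idP => [/set_mem//|]; exact: mem_set.
by case: (Hh f) => _ ->.
Qed.

Variables (H' H'' : seq (hash_function V n)) (h' h'' : T -> hash_function V n).
Hypotheses (Hpw' : pairwise_independent_family H')
  (Hpw'' : pairwise_independent_family H'').
Hypotheses (hh' : uniform_draw P H' h') (hh'' : uniform_draw P H'' h'').

Let X w := (h' w, h'' w).

Lemma measurable_hash_pair z : measurable (X @^-1` [set z]).
Proof.
case: z => f g; have [[mf _] [mg _]] := (hh' f, hh'' g).
rewrite (_ : _ @^-1` _ = (h' @^-1` [set f]) `&` (h'' @^-1` [set g])).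
  exact: measurableI.
by apply/seteqP; split => w; rewrite /X/= => -[-> ->].
Qed.

Lemma edge_collision_probability (x y u v : V) : (x, y) != (u, v) ->
  fine (P (X @^-1` [set z : hash_function V n * hash_function V n |
    (z.1 x == z.1 u) && (z.2 y == z.2 v)])) <= n%:R^-1.
Proof.
move=> xyuv; have mX := measurable_preimage_fin measurable_hash_pair.
have mh' := measurable_preimage_fin (fun f => (hh' f).1).
have mh'' := measurable_preimage_fin (fun f => (hh'' f).1).
have [xu|xu] := eqVneq x u; last first.
  rewrite -(collision_probability Hpw' hh' xu).
  apply: fine_le; [exact/fin_num_measure/mX|exact/fin_num_measure/mh'|].
  by apply: le_measure; rewrite ?inE; [exact: mX|exact: mh'|move=> w /= /andP[]].
have yv : y != v by apply: contraNneq xyuv => ->; rewrite xu.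
rewrite -(collision_probability Hpw'' hh'' yv).
apply: fine_le; [exact/fin_num_measure/mX|exact/fin_num_measure/mh''|].
by apply: le_measure; rewrite ?inE; [exact: mX|exact: mh''|move=> w /= /andP[]].
Qed.

Lemma row_failure_probability (eps : R) (s : stream V) (u v : V) :
  expR 1 / eps <= n%:R -> 0 < eps ->
  fine (P (X @^-1` [set z : hash_function V n * hash_function V n |
    (true_count s u v)%:R + eps * (total_count s)%:R <
             (sketch_matrix z.1 z.2 s (z.1 u) (z.2 v))%:R :> R]))
    <= expR (-1).
Proof.
move=> epsn eps0.
pose F (z : hash_function V n * hash_function V n) : R :=
  \sum_(e <- s | e.1 != (u, v))
    ((z.1 e.1.1 == z.1 u) && (z.2 e.1.2 == z.2 v))%:R * e.2%:R.
have F0 z : 0 <= F z by apply: sumr_ge0 => e _; rewrite mulr_ge0.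
set M := (total_count s)%:R.
rewrite (_ : [set _ | _] = [set z | eps * M < F z]); last first.
  apply/seteqP; split => z /=; rewrite sketch_matrix_excess natrD ltrD2l;
    rewrite natr_sum;
  by under eq_bigr do rewrite natrM.
have FM z : F z <= M.
  rewrite /M total_countE natr_sum /F big_mkcond/=; apply: ler_sum => e _.
  by case: ifP => // _; case: (_ && _); rewrite ?mul1r ?mul0r.
(* Markov's bound is useful only if [eps * M] is positive. For [M = 0] the bound [F z <= M] makes
   the failure event empty. *)
have [M0|M0] := leP M 0.
  rewrite (_ : [set _ | _] = set0) ?preimage_set0 ?measure0 ?expR_ge0//.
  have {}M0 : M = 0 by apply/eqP; rewrite eq_le M0 ler0n.
  apply/seteqP; split => z //=; rewrite M0 mulr0 ltNge => /negP; apply.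
  by rewrite -M0.
rewrite -(@ler_pM2l _ (eps * M)) ?mulr_gt0//.
apply: (le_trans (markov_fin P measurable_hash_pair _ F0)).
(* The expected excess is at most [M / n], and [epsn] bounds this by [eps * M / e]. *)
apply: (@le_trans _ _ (n%:R^-1 * M)); last first.
  rewrite mulrAC ler_pM2r// expRN -[leRHS]invf_div lef_pV2 ?posrE//.
  - by rewrite ltr0n.
  - by rewrite divr_gt0 ?expR_gt0.
under eq_bigr do rewrite mulr_sumr.
(* Linearity of expectation: it now suffices to compare the contributions of each stream entry. *)
rewrite exchange_big/= /M total_countE natr_sum mulr_sumr big_mkcond/=.
apply: ler_sum => -[[x y] c] _ /=; case: ifPn => [xyuv|_];
  last by rewrite mulr_ge0.
under eq_bigr do rewrite mulrA.
rewrite -mulr_suml ler_wpM2r//.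
apply: le_trans (edge_collision_probability xyuv).
rewrite (probability_preimage_fin P measurable_hash_pair) [leRHS]big_mkcond/=.
apply: ler_sum => z _; case: ifPn => [_|].
  by rewrite ler_piMr ?fine_ge0 ?lern1 ?leq_b1.
by rewrite notin_setE/= => /negP/negbTE ->; rewrite mulr0.
Qed.

End sketch_row.

Theorem theorem4p1 (R : realType) (d : measure_display) (T : measurableType d)
  (P : probability T R) (V : finType) (eps delta : R) (nr nb : nat)
  (heps : 0 < eps) (hdelta : 0 < delta)
  (hnr : nr%:Z = Num.ceil (ln (1 / delta)))
  (hnb : nb%:Z = Num.ceil (expR 1 / eps))
  (H' H'' : 'I_nr -> seq (hash_function V nb))
  (hH' : forall k : 'I_nr, pairwise_independent_family (H' k))
  (hH'' : forall k : 'I_nr, pairwise_independent_family (H'' k))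
  (h' h'' : 'I_nr -> T -> hash_function V nb)
  (hh' : forall k : 'I_nr, uniform_draw P (H' k) (h' k))
  (hh'' : forall k : 'I_nr, uniform_draw P (H'' k) (h'' k))
  (hind : mutually_independent P
            (fun (k : 'I_nr) (w : T) => (h' k w, h'' k w)))
  (s : stream V) (u v : V) :
  ((1 - delta)%:E <=
    P [set w | (estimate R (fun k => h' k w) (fun k => h'' k w) s u v <=
                 ((true_count s u v)%:R + eps * (total_count s)%:R)%:E)%E])%E.
Proof.
have nbE : expR 1 / eps <= nb%:R by rewrite pmulrn hnb ceil_ge.
have nrE : ln (1 / delta) <= nr%:R by rewrite pmulrn hnr ceil_ge.
have nb0 : (0 < nb)%N.
  by rewrite -(ltr0n R) (lt_le_trans _ nbE)// divr_gt0 ?expR_gt0.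
set c : R := (true_count s u v)%:R + eps * (total_count s)%:R.
pose B := [set z : hash_function V nb * hash_function V nb |
  c < (sketch_matrix z.1 z.2 s (z.1 u) (z.2 v))%:R].
pose X k w := (h' k w, h'' k w).
have mXB k : measurable (X k @^-1` B).
  exact: measurable_preimage_fin (measurable_hash_pair (hh' k) (hh'' k)) _.
(* The index set is written as a full finite set to match [mutually_independent]. *)
pose failure := \bigcap_(k in [set` [set: 'I_nr]%SET]) (X k @^-1` B).
have mcap : measurable failure.
  exact: fin_bigcap_measurable.
rewrite (_ : [set w | _] = ~` failure); last first.
  apply/seteqP; split => w /=.
    (* The default value [+oo] of the minimum is not below the real [c], so some row [k] attains the
       bound. *)
    case/bigmin_leP => [//|[k _ Mk]] fail_w.
    have := fail_w k (finset.in_setT k).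
    by rewrite /B/= ltNge -lee_fin => /negP/(_ Mk).
  move=> nB; rewrite leNgt; apply/negP => cw; apply: nB => k _ /=.
  by rewrite /B/= -lte_fin (lt_le_trans cw)// bigmin_le.
rewrite probability_setC// hind.
rewrite (eq_bigr (fun k => (fine (P (X k @^-1` B)))%:E)); last first.
  by move=> k _; rewrite fineK// fin_num_measure.
rewrite prodEFin -EFinB lee_fin lerD2l lerN2.
apply: (@le_trans _ _ (\prod_(k in [set: 'I_nr]%SET) expR (-1))).
  apply: ler_prod => k _; rewrite fine_ge0//=.
  exact: row_failure_probability (hH' k) (hH'' k) (hh' k) (hh'' k) _ _ _ _ _ _.
rewrite prodr_const cardsT card_ord -expRM_natl mulrN1 expRN.
(* Taking inverses leaves [delta^-1 <= expR nr%:R], which is the exponential of [nrE]. *)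
rewrite -[leRHS]invrK lef_pV2 ?posrE ?invr_gt0 ?expR_gt0//.
by rewrite -[leLHS]lnK ?posrE ?invr_gt0// ler_expR -div1r.
Qed.
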